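(* Let $0<p<1$ and let $D_{n,p}$ be the (random) graph distance matrix of an Erdős–Rényi random graph in $G(n,p)$. Then, as $n\to\infty$, $$\mathbb{P}\left(\det(D_{n,p})=0\right)\to 0.$$
   Context: The Erdős–Rényi random graph $G(n,p)$ is the random simple graph on the labeled vertex set $\{v_1,\dots,v_n\}$ in which each pair $\{v_i,v_j\}$ with $i\neq j$ is joined by an edge independently with probability $p$. The parameter $p$ is fixed while $n\to\infty$. The graph distance matrix of a connected graph has entries $D_{ij}=d(v_i,v_j)$ (shortest-path distance). On the event that the random graph is disconnected, $D_{n,p}$ is set to an arbitrary fixed real $n\times n$ matrix by convention. *)

(* Defs.v *)
From HB Require Import structures.
From mathcomp Require Import all_boot all_order all_algebra.
From mathcomp Require Import all_classical all_reals all_analysis.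

Set Implicit Arguments.
Unset Strict Implicit.
Unset Printing Implicit Defensive.

Import Order.TTheory GRing.Theory Num.Theory.
Import numFieldNormedType.Exports.

Local Open Scope ring_scope.

(** A simple graph on the vertex set ['I_n] is given by its edge set, a subset
    of [vpairs n]. *)

Definition vpairs (n : nat) : {set {set 'I_n}} :=
  [set e : {set 'I_n} | #|e| == 2%N].

(** Irreflexive when [E \subset vpairs n], since [[set i; i]] has one element. *)
Definition adj (n : nat) (E : {set {set 'I_n}}) : rel 'I_n :=
  fun i j => [set i; j] \in E.

Definition walk (V : finType) (e : rel V) (k : nat) (i j : V) : bool :=
  [exists t : k.-tuple V, path e i t && (last i t == j)].

(** The least length of a walk from [i] to [j].  Lengths below [#|V|] suffice
    when [j] is reachable from [i] (see [gdistP]); otherwise the value is the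
    junk value [#|V|]. *)
Definition gdist (V : finType) (e : rel V) (i j : V) : nat :=
  find (fun k => walk e k i j) (iota 0 #|V|).

Definition gconnected (V : finType) (e : rel V) : bool :=
  [forall i, forall j, connect e i j].

(** The distance matrix of the graph with edge set [E], replaced by [C] when the
    graph is disconnected. *)
Definition dist_mx (R : realType) (n : nat) (C : 'M[R]_n)
    (E : {set {set 'I_n}}) : 'M[R]_n :=
  if gconnected (adj E) then \matrix_(i, j) (gdist (adj E) i j)%:R else C.

(** The probability of the event [A] in G(n,p): the product over all pairs of
    vertices of the Bernoulli([p]) law, on the finite space of edge sets. *)
Definition gnp_prob (R : realType) (n : nat) (p : R)
    (A : pred {set {set 'I_n}}) : R :=
  \sum_(E in powerset (vpairs n) | A E)
    \prod_(e in vpairs n) (if e \in E then p else 1 - p).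

Lemma walkP (V : finType) (e : rel V) (k : nat) (i j : V) :
  reflect (exists s : seq V, [/\ size s = k, path e i s & last i s = j])
          (walk e k i j).
Proof.
apply: (iffP existsP) => [[t /andP[ep /eqP lj]]|[s [sk ep lj]]].
  by exists t; rewrite size_tuple.
by exists (Tuple (introT eqP sk)); rewrite /= ep lj eqxx.
Qed.

Lemma gdistP (V : finType) (e : rel V) (i j : V) : connect e i j ->
  walk e (gdist e i j) i j /\
  (forall k, walk e k i j -> (gdist e i j <= k)%N).
Proof.
move=> /connectP[s ep lj].
set a := fun k => walk e k i j.
have ha : has a (iota 0 #|V|).
  case/shortenP: ep lj => s' ep' us' _ lj.
  apply/hasP; exists (size s'); last by apply/walkP; exists s'.
  by rewrite mem_iota /= add0n (leq_trans _ (max_card [in i :: s'])) ?(card_uniqP us').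
have lt : (gdist e i j < #|V|)%N by move: ha; rewrite has_find size_iota.
split; first by have := nth_find 0 ha; rewrite nth_iota.
move=> k wk; rewrite leqNgt; apply/negP => kd.
have := before_find 0 kd.
by rewrite nth_iota ?add0n ?wk //; exact: ltn_trans kd lt.
Qed.

(** [S := set0] gives total mass 1; in general, the edges are mutually
    independent, each present with probability [p]. *)
Lemma gnp_prob_edges (R : realType) (n : nat) (p : R) (S : {set {set 'I_n}}) :
  S \subset vpairs n -> gnp_prob p (fun E => S \subset E) = p ^+ #|S|.
Proof.
move=> SV; set V := vpairs n.
pose F e := if e \in V then p else 0.
pose G e := if e \in V then (if e \in S then 0 else 1 - p) else 1.
transitivity (\prod_(e : {set 'I_n}) (F e + G e)).
  rewrite bigA_distr /gnp_prob big_mkcond; apply: eq_bigr => E _.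
  rewrite powersetE; case: ifP => [/andP[EV SE]|/negbT].
    rewrite big_mkcond; apply: eq_bigr => e _; rewrite /F /G.
    case: ifP => eV; case: ifP => eE //.
      by case: ifP => // /(fintype.subsetP SE); rewrite eE.
    by move/(fintype.subsetP EV): eE; rewrite -/V eV.
  rewrite negb_and => /orP[] /subsetPn[e e1 e2]; symmetry.
    by rewrite (bigD1 e) //= e1 /F -/V (negbTE e2) mul0r.
  by rewrite (bigD1 e) //= (negbTE e2) /G e1 (fintype.subsetP SV _ e1) mul0r.
rewrite -prodr_const [RHS]big_mkcond; apply: eq_bigr => e _; rewrite /F /G.
have [eS|_] := ifPn (e \in S); first by rewrite (fintype.subsetP SV _ eS) addr0.
by case: ifP; rewrite ?add0r // addrC subrK.
Qed.

(* Main.v *)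
Require Import Defs.
From HB Require Import structures.
From mathcomp Require Import all_boot all_order all_algebra.
From mathcomp Require Import ring lra.
From mathcomp Require Import all_classical all_reals all_analysis.
From mathcomp Require Import fintype finset.
Set Implicit Arguments.
Unset Strict Implicit.
Unset Printing Implicit Defensive.
Import Order.TTheory GRing.Theory Num.Theory.
Import numFieldNormedType.Exports.
Local Open Scope ring_scope.

(** With probability tending to 1, any two vertices have a common neighbour.  The
    distance matrix is then [dist2_mx], the symmetric matrix [M] with zero diagonal
    whose off-diagonal entries are independent up to symmetry, [1] on edges and [2]
    elsewhere.  It remains to see that such a matrix is rarely singular; this is a
    theorem of Costello, Tao and Vu, proved here with a double counting in place
    of their analysis of the rank of growing minors.

    First, [M] rarely has a sparse near-kernel vector.  Call it a defect if some
    nonzero [u] is such that [u] and [M *m u] are both supported in one set of at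
    most [s] indices, where [s] is a small multiple of [n].  Outside that set the
    rows are independent; at most [s] of them determine a vector [u], and every
    further row must then be orthogonal to [u], which costs a constant factor
    [rho < 1] each.  The number of choices is beaten by [rho ^+ (n - 2 * s)]
    ([prob_sparse_defect], [sparse_error_small]).

    Now let [M] be singular without defect.  A kernel vector [z] has more than [s]
    nonzero entries, a positive fraction of all.  Hence it is enough to bound, for
    each fixed vertex [i], the probability that there is a kernel vector with
    [z i 0 = -1]; Markov's inequality then loses only the constant factor [n / s]
    ([prob_det_dist2]).  Fix all edges avoiding [i], let [Q] be [M] without its
    [i]-th row and column, and let [v] be the [i]-th column, which is random and
    independent of [Q].  The existence of [z] says that [v = Q *m z] and that [v]
    is orthogonal to [z].  If [Q] is singular with kernel vector [u], then [v] is
    orthogonal to [u]; if [Q] is invertible, then the quadratic form of its inverse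
    vanishes at [v].  As [Q] has no defect either, [u] and the columns of the
    inverse of [Q] have many nonzero entries, and both events are unlikely by
    anti-concentration ([prob_border_singular]).

    Anti-concentration of linear forms is [littlewood_offord], a second moment
    argument.  That of quadratic forms, [quadratic_littlewood_offord], follows
    by decoupling. *)

(** * Product Bernoulli measures on subsets of a finite set *)

Lemma sum_sets_prod (R : comPzSemiRingType) (T : finType) (F G : T -> R) :
  \sum_(x : {set T}) \prod_e (if e \in x then F e else G e) = \prod_e (F e + G e).
Proof. by rewrite bigA_distr; apply: eq_bigl => x; rewrite inE. Qed.

Section BernoulliSets.
Variables (R : realFieldType) (T : finType) (p : T -> R).

(** The law of a random subset of [T] to which every [e] belongs independently
    with its own probability [p e].  Non-constant [p] lets coordinates with
    [p e = 0] stand for potential edges that do not exist. *)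
Definition bweight (x : {set T}) : R :=
  \prod_e (if e \in x then p e else 1 - p e).

Definition expect (f : {set T} -> R) : R := \sum_x bweight x * f x.

Definition prob (A : pred {set T}) : R := expect (fun x => (A x)%:R).

(** Independence is expressed by exchanging coordinates of two independent copies:
    [splice K x y] follows [x] on [K] and [y] off [K].  All random objects
    thus live on the same space, and conditioning on the coordinates outside [K]
    amounts to freezing [y]. *)
Definition splice (K x y : {set T}) : {set T} := (x :&: K) :|: (y :\: K).

Lemma in_splice K x y e : (e \in splice K x y) = (e \in (if e \in K then x else y)).
Proof. by rewrite !inE; case: (e \in K); rewrite ?andbT ?andbF ?orbF. Qed.

Lemma eq_expect f g : f =1 g -> expect f = expect g.
Proof. by move=> fg; apply: eq_bigr => x _; rewrite fg. Qed.

Lemma expectD f g : expect (fun x => f x + g x) = expect f + expect g.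
Proof. by rewrite -big_split; apply: eq_bigr => x _; rewrite mulrDr. Qed.

Lemma expectZ c f : expect (fun x => c * f x) = c * expect f.
Proof. by rewrite mulr_sumr; apply: eq_bigr => x _; rewrite mulrCA. Qed.

Lemma expect_sum (I : finType) (P : pred I) (f : I -> {set T} -> R) :
  expect (fun x => \sum_(i | P i) f i x) = \sum_(i | P i) expect (f i).
Proof.
rewrite exchange_big; apply: eq_bigr => x _; by rewrite mulr_sumr.
Qed.

Lemma sum_bweight : \sum_x bweight x = 1.
Proof. by rewrite sum_sets_prod big1 // => e _; rewrite addrC subrK. Qed.

Lemma expect_cst c : expect (fun=> c) = c.
Proof. by rewrite /expect -mulr_suml sum_bweight mul1r. Qed.

Lemma bweight_splice K x y :
  bweight (splice K x y) * bweight (splice K y x) = bweight x * bweight y.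
Proof.
rewrite -!big_split; apply: eq_bigr => e _.
by rewrite !in_splice; case: (e \in K) => //=; rewrite mulrC.
Qed.

(** Swapping the coordinates in [K] between two independent copies is an
    involution of pairs that preserves the product weight. *)
Lemma expect_splice2 K (f : {set T} -> {set T} -> R) :
  expect (fun x => expect (fun y => f (splice K x y) (splice K y x)))
  = expect (fun x => expect (f x)).
Proof.
pose sw (u : {set T} * {set T}) := (splice K u.1 u.2, splice K u.2 u.1).
have swK : involutive sw.
  move=> [x y]; congr (_, _); apply/setP => e; rewrite !in_splice;
  by case: ifP => eK; rewrite in_splice eK.
have E g : expect (fun x => expect (g x)) =
    \sum_(u : {set T} * {set T}) bweight u.1 * bweight u.2 * g u.1 u.2.
  rewrite -(pair_bigA _ (fun x y => bweight x * bweight y * g x y)) /=.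
  by apply: eq_bigr => x _; rewrite mulr_sumr; apply: eq_bigr => y _; rewrite mulrA.
rewrite !E [RHS](reindex_inj (inv_inj swK)) /=.
by apply: eq_bigr => -[x y] _ /=; rewrite bweight_splice.
Qed.

Lemma expect_splice K f :
  expect (fun x => expect (fun y => f (splice K x y))) = expect f.
Proof.
rewrite (expect_splice2 K (fun x _ => f x)).
by apply: eq_expect => x; rewrite expect_cst.
Qed.

Lemma expect_indep K f g :
  (forall x y, f (splice K x y) = f x) -> (forall x y, g (splice K y x) = g x) ->
  expect (fun x => f x * g x) = expect f * expect g.
Proof.
move=> fK gK; transitivity (expect (fun x => expect (fun y => f x * g y))).
  rewrite -(expect_splice2 K (fun x y => f x * g y)).
  by apply: eq_expect => x; rewrite -[LHS]expect_cst; apply: eq_expect => y; rewrite fK gK.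
rewrite mulrC -expectZ; apply: eq_expect => x; by rewrite expectZ mulrC.
Qed.

Lemma exchange_expect (f : {set T} -> {set T} -> R) :
  expect (fun x => expect (f x)) = expect (fun y => expect (f^~ y)).
Proof.
rewrite /expect; under eq_bigr do rewrite mulr_sumr.
rewrite exchange_big; apply: eq_bigr => y _; rewrite mulr_sumr.
by apply: eq_bigr => x _; rewrite mulrCA.
Qed.

Lemma prob_in e : prob (fun x => e \in x) = p e.
Proof.
pose G c := if c == e then 0 else 1 - p c.
transitivity (\prod_c (p c + G c)).
  rewrite -sum_sets_prod; apply: eq_bigr => x _.
  case: (boolP (e \in x)) => ex.
    rewrite mulr1; apply: eq_bigr => c _; rewrite /G; case: ifP => // /negbT cx.
    by case: eqVneq cx => // ->; rewrite ex.
  by rewrite mulr0 (bigD1 e) //= (negPf ex) /G eqxx mul0r.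
rewrite (bigD1 e) //= /G eqxx addr0 big1 ?mulr1 // => c /negPf->.
by rewrite addrC subrK.
Qed.

(** Resampling the single coordinate [e]. *)
Lemma expect_coord e f :
  expect f = expect (fun x => p e * f (e |: x) + (1 - p e) * f (x :\ e)).
Proof.
rewrite -[LHS](expect_splice (~: [set e])); apply: eq_expect => x.
transitivity (expect (fun y => f (x :\ e) + (e \in y)%:R * (f (e |: x) - f (x :\ e)))).
  apply: eq_expect => y.
  have [ey|ey] := boolP (e \in y); rewrite ?mul1r ?mul0r ?addr0 1?addrC ?subrK; congr f;
  by apply/setP => c; rewrite in_splice !inE; case: eqVneq => //= ->; rewrite ?(negPf ey).
rewrite expectD expect_cst.
transitivity (f (x :\ e) + (f (e |: x) - f (x :\ e)) * prob (fun y => e \in y)).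
  by congr (_ + _); rewrite -expectZ; apply: eq_expect => y; rewrite mulrC.
by rewrite prob_in; ring.
Qed.

Hypothesis p01 : forall e, 0 <= p e <= 1.

Lemma bweight_ge0 x : 0 <= bweight x.
Proof.
by apply: prodr_ge0 => e _; case: ifP => _; have /andP[p0 p1] := p01 e; rewrite ?subr_ge0.
Qed.

Lemma le_expect f g : (forall x, f x <= g x) -> expect f <= expect g.
Proof. by move=> fg; apply: ler_sum => x _; apply: ler_wpM2l => //; apply: bweight_ge0. Qed.

Lemma expect_ge0 f : (forall x, 0 <= f x) -> 0 <= expect f.
Proof. by move=> f0; rewrite -(expect_cst 0); apply: le_expect. Qed.

Lemma expect_le c f : (forall x, f x <= c) -> expect f <= c.
Proof. by move=> fc; rewrite -[leRHS](expect_cst c); apply: le_expect. Qed.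

Lemma sqr_expect_le f : expect f ^+ 2 <= expect (fun x => f x ^+ 2).
Proof.
set m := expect f.
have : 0 <= expect (fun x => (f x - m) ^+ 2).
  by apply: expect_ge0 => x; apply: sqr_ge0.
have -> : expect (fun x => (f x - m) ^+ 2) = expect (fun x => f x ^+ 2) - m ^+ 2.
  transitivity (expect (fun x => f x ^+ 2 + (- (2 * m) * f x + m ^+ 2))).
    by apply: eq_expect => x; ring.
  rewrite !expectD expectZ expect_cst -/m; ring.
by rewrite subr_ge0.
Qed.

Lemma prob_ge0 A : 0 <= prob A.
Proof. by apply: expect_ge0 => x; rewrite ler0n. Qed.

Lemma prob_le1 A : prob A <= 1.
Proof. by apply: expect_le => x; rewrite lern1 leq_b1. Qed.

Lemma prob_union_le (I : finType) (P : pred I) (A : pred {set T})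
    (B : I -> pred {set T}) :
  (forall x, A x -> exists2 i, P i & B i x) -> prob A <= \sum_(i | P i) prob (B i).
Proof.
move=> AB; rewrite -expect_sum; apply: le_expect => x.
case: (boolP (A x)) => [/AB[i Pi Bi]|_]; last by apply: sumr_ge0 => i _; rewrite ler0n.
by rewrite (bigD1 i) //= Bi lerDl sumr_ge0 // => j _; rewrite ler0n.
Qed.

Lemma prob_sub (A B : pred {set T}) : (forall x, A x -> B x) -> prob A <= prob B.
Proof. by move=> AB; apply: le_expect => x; rewrite ler_nat; case: (A x) (AB x) => // ->. Qed.

Lemma prob_or (A B C : pred {set T}) :
  (forall x, A x -> B x \/ C x) -> prob A <= prob B + prob C.
Proof.
move=> ABC; rewrite -expectD; apply: le_expect => x; rewrite -natrD ler_nat.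
by case: (A x) (ABC x) => // -[]// ->; rewrite ?leq_addr // leq_addl.
Qed.

(** * Anti-concentration *)

(** Integration by parts in one coordinate: correlation with a centred
    coordinate is the discrete derivative in that direction, times the variance.
    It is what makes the Littlewood-Offord bound below a second moment
    computation. *)
Lemma expect_centered e f :
  expect (fun x => ((e \in x)%:R - p e) * f x) =
  p e * (1 - p e) * expect (fun x => f (e |: x) - f (x :\ e)).
Proof.
rewrite (expect_coord e) -expectZ; apply: eq_expect => x /=.
by rewrite setU11 setD11 mulr1n mulr0n; ring.
Qed.

(** Littlewood-Offord inequality.  Let [S] be the linear form, [f] the sign of
    [S - c], and [Z] the sum of the centred coordinates weighted by the signs of
    their coefficients.  By [expect_centered], the correlation of [Z] and [f] is
    a sum of variances times increments of [f] in the direction in which [S]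
    grows; these are nonnegative, and at least [1] where [S = c].  Hence
    the correlation is at least [s2 * P].  Since [|f| <= 1] and [Z] has
    variance [s2], Cauchy-Schwarz bounds it by the square root of [s2]. *)
Lemma littlewood_offord (a : T -> R) (c : R) :
  (\sum_(e | a e != 0) p e * (1 - p e))
    * prob (fun x => \sum_(e in x) a e == c) ^+ 2 <= 1.
Proof.
pose S (x : {set T}) : R := \sum_(e in x) a e.
set s2 := \sum_(e | _) _; set P := prob _.
pose f x := Num.sg (S x - c).
pose Z (x : {set T}) := \sum_e Num.sg (a e) * ((e \in x)%:R - p e).
have expZ g : expect (fun x => Z x * g x) =
    \sum_(e | a e != 0) p e * (1 - p e) *
      expect (fun x => Num.sg (a e) * (g (e |: x) - g (x :\ e))).
  transitivity (expect (fun x => \sum_e Num.sg (a e) * (((e \in x)%:R - p e) * g x))).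
    by apply: eq_expect => x; rewrite mulr_suml; apply: eq_bigr => e _; rewrite mulrA.
  rewrite expect_sum [RHS]big_mkcond; apply: eq_bigr => e _.
  rewrite expectZ expect_centered expectZ mulrCA.
  by case: eqVneq => //= ->; rewrite sgr0 mul0r mulr0.
have SU e x : S (e |: x) = S (x :\ e) + a e.
  rewrite /S (big_setD1 e) ?setU11 //= addrC; congr (_ + _).
  by apply: eq_bigl => d; rewrite !inE; case: eqP.
have s2_ge0 : 0 <= s2.
  by apply: sumr_ge0 => e _; have /andP[? ?] := p01 e; apply: mulr_ge0; rewrite ?subr_ge0.
have ZZ : expect (fun x => Z x * Z x) = s2.
  rewrite expZ; apply: eq_bigr => e ae.
  transitivity (p e * (1 - p e) * expect (fun=> 1)); last by rewrite expect_cst mulr1.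
  congr (_ * _); apply: eq_expect => x.
  have -> : Z (e |: x) - Z (x :\ e) = Num.sg (a e).
    rewrite /Z (bigD1 e) //= [X in _ - X](bigD1 e) //= setU11 setD11.
    rewrite [X in _ + X - _](eq_bigr (fun d => Num.sg (a d) * ((d \in x :\ e)%:R - p d))).
      by rewrite mulr1n mulr0n; ring.
    by move=> d de; rewrite !inE (negPf de).
  by rewrite -sgrM -expr2 gtr0_sg // lt0r sqrf_eq0 ae sqr_ge0.
have Zf : s2 * P <= expect (fun x => Z x * f x).
  rewrite expZ mulr_suml; apply: ler_sum => e ae; apply: ler_wpM2l.
    by have /andP[? ?] := p01 e; apply: mulr_ge0; rewrite ?subr_ge0.
  apply: le_expect => x; rewrite -[X in (X == c)]/(S x) /f SU.
  have /orP[xe|xe] : (x == e |: x) || (x == x :\ e).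
    have [ex|ex] := boolP (e \in x); apply/orP; [left|right]; apply/eqP/setP => d;
    by rewrite !inE; case: eqVneq => // ->; rewrite ?(negPf ex) ?ex.
  - have -> : S x = S (x :\ e) + a e by rewrite -SU -(eqP xe).
    set s := S _.
    case: (sgrP (a e)) ae => // ae _; case: (sgrP (s + _ - _)) => h1; case: (sgrP (s - _)) => h2;
    case: eqP => h3 /=; lra.
  - have -> : S x = S (x :\ e) by rewrite -(eqP xe).
    set s := S _.
    case: (sgrP (a e)) ae => // ae _; case: (sgrP (s + _ - _)) => h1; case: (sgrP (s - _)) => h2;
    case: eqP => h3 /=; lra.
(* Cauchy-Schwarz, from the variance of [Z - m f]. *)
have m2 : expect (fun x => Z x * f x) ^+ 2 <= s2.
  set m := expect (fun x => Z x * f x).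
  have : 0 <= expect (fun x => (Z x - m * f x) ^+ 2).
    by apply: expect_ge0 => x; apply: sqr_ge0.
  have f1 : expect (fun x => f x ^+ 2) <= 1.
    by apply: expect_le => x; rewrite /f; case: sgrP => _; lra.
  have -> : expect (fun x => (Z x - m * f x) ^+ 2) =
      s2 - 2 * m ^+ 2 + m ^+ 2 * expect (fun x => f x ^+ 2).
    transitivity (expect (fun x => Z x * Z x + (- (2 * m) * (Z x * f x) + m ^+ 2 * f x ^+ 2))).
      by apply: eq_expect => x; ring.
    by rewrite !expectD !expectZ -/m ZZ; ring.
  have := sqr_ge0 m; set q := m ^+ 2; nra.
have P0 : 0 <= P by apply: prob_ge0.
have : (s2 * P) ^+ 2 <= s2.
  have sP0 : 0 <= s2 * P by apply: mulr_ge0.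
  by apply: le_trans m2; rewrite !expr2 ler_pM.
have [->|s20] := eqVneq s2 0; first by rewrite !mul0r ler01.
by rewrite exprMn expr2 -mulrA -[leRHS]mulr1 ler_pM2l // lt0r s20.
Qed.

Lemma littlewood_offord_le (a : T -> R) (c tau delta : R) (S : {set T}) :
  0 <= delta -> (forall e, e \in S -> a e != 0) ->
  (forall e, e \in S -> tau <= p e * (1 - p e)) ->
  1 <= delta ^+ 2 * (tau * #|S|%:R) ->
  prob (fun x => \sum_(e in x) a e == c) <= delta.
Proof.
move=> d0 aS tauS dS; have := littlewood_offord a c.
set s2 := \sum_(e | _) _; set P := prob _ => LO.
have le_s2 : tau * #|S|%:R <= s2.
  rewrite mulr_natr -sumr_const [leRHS](bigID (mem S)) /=.
  have -> : \sum_(e | (a e != 0) && (e \in S)) p e * (1 - p e) =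
      \sum_(e in S) p e * (1 - p e).
    by apply: eq_bigl => e; apply: andb_idl => /aS.
  apply: le_trans (ler_sum _ _) _; first by move=> e; apply: tauS.
  rewrite lerDl; apply: sumr_ge0 => e _; have /andP[? ?] := p01 e.
  by apply: mulr_ge0; rewrite ?subr_ge0.
have P0 : 0 <= P by apply: prob_ge0.
have d2 := sqr_ge0 delta.
have h : 1 <= delta ^+ 2 * s2 by apply: le_trans dS _; apply: ler_wpM2l.
have s20 : 0 < s2 by rewrite ltNge; apply/negP => s2n; nra.
have : P ^+ 2 <= delta ^+ 2.
  by rewrite -(ler_pM2l s20) (le_trans LO) // mulrC.
by rewrite ler_sqr ?nnegrE.
Qed.

Lemma sqr_expect (f : {set T} -> R) :
  expect f ^+ 2 = expect (fun x => expect (fun y => f x * f y)).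
Proof.
rewrite expr2 -expectZ; apply: eq_expect => x; rewrite expectZ; exact: mulrC.
Qed.

(** Two applications of Cauchy-Schwarz, first over the coordinates outside [J],
    then over a pair of copies of those in [J]: an event of probability [P]
    holds simultaneously at the four corners of a random combinatorial rectangle
    with probability at least [P ^ 4]. *)
Lemma decoupling (J : {set T}) (B : pred {set T}) :
  prob B ^+ 4 <= expect (fun y => expect (fun y' => expect (fun x' => prob (fun x =>
    [&& B (splice J y x), B (splice J y' x), B (splice J y x') & B (splice J y' x')])))).
Proof.
pose b x y : R := (B (splice J y x))%:R.
have Pb : prob B = expect (fun x => expect (b x)).
  by rewrite -exchange_expect; symmetry; apply: (expect_splice J (fun z => (B z)%:R)).
pose h y y' := expect (fun x => b x y * b x y').
have P2 : prob B ^+ 2 <= expect (fun y => expect (h y)).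
  rewrite Pb (le_trans (sqr_expect_le _)) //.
  rewrite le_eqVlt; apply/orP; left; apply/eqP.
  transitivity (expect (fun x => expect (fun y => expect (fun y' => b x y * b x y')))).
    by apply: eq_expect => x; rewrite sqr_expect.
  rewrite exchange_expect; apply: eq_expect => y; by rewrite exchange_expect.
have b0 x y : 0 <= b x y by rewrite /b ler0n.
rewrite (exprM _ 2 2).
apply: (@le_trans _ _ (expect (fun y => expect (h y)) ^+ 2)).
  by rewrite ler_sqr ?nnegrE ?sqr_ge0 // (le_trans _ P2) ?sqr_ge0.
apply: le_trans (sqr_expect_le _) _; apply: le_expect => // y.
apply: le_trans (sqr_expect_le _) _; apply: le_expect => // y'.
rewrite /h sqr_expect exchange_expect; apply: le_expect => // x'; apply: le_expect => // x.
rewrite /b; case: (B (splice J y x)); case: (B (splice J y' x)); 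
case: (B (splice J y x')); case: (B (splice J y' x')); by rewrite -!natrM ler_nat.
Qed.

(** At the four corners given by [decoupling], the alternating sum of the
    quadratic form only retains the bilinear part between [J] and its complement;
    it is a linear form in [x] whose coefficient at [i] is [r i y - r i y'].
    For each [i] in [I] that coefficient vanishes with probability at most
    [delta], by the linear inequality in [y].  By Markov's inequality at least
    half of them survive except with probability [2 * delta], and then the
    linear inequality in [x] contributes a last [delta]. *)
Lemma quadratic_littlewood_offord (a : T -> T -> R) (b : T -> R) (c tau delta : R)
    (I J : {set T}) (k : nat) :
  (forall i j, a i j = a j i) -> [disjoint I & J] -> 0 <= tau -> 0 <= delta ->
  (forall e, e \in I :|: J -> tau <= p e * (1 - p e)) ->
  (forall i, i \in I -> (k <= #|[set j in J | a i j != 0%R]|)%N) ->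
  1 <= delta ^+ 2 * (tau * k%:R) -> 2 <= delta ^+ 2 * (tau * #|I|%:R) ->
  prob (fun x => \sum_i \sum_j a i j * ((b i - (i \in x)%:R) * (b j - (j \in x)%:R)) == c) ^+ 4
    <= 3 * delta.
Proof.
move=> asym dIJ tau0 d0 tauIJ kI dk dI.
have I0 : 0 < #|I|%:R :> R.
  rewrite ltr0n lt0n; apply: contraTneq dI => ->.
  by rewrite mulr0 mulr0 -ltNge ltr0n.
pose aJ i j := if j \in J then a i j else 0.
pose r i (y : {set T}) : R := \sum_(j in y) aJ i j.
pose N0 y y' : R := \sum_(i in I) (r i y == r i y')%:R.
have EN0 y' : expect (fun y => N0 y y') <= #|I|%:R * delta.
  rewrite expect_sum mulr_natl -sumr_const; apply: ler_sum => i iI.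
  apply: (@littlewood_offord_le _ _ tau delta [set j in J | a i j != 0]) => //.
  - by move=> j; rewrite inE /aJ => /andP[->].
  - by move=> j; rewrite inE => /andP[jJ _]; apply: tauIJ; rewrite inE jJ orbT.
  - apply: le_trans dk _; apply: ler_wpM2l; first exact: sqr_ge0.
    by apply: ler_wpM2l => //; rewrite ler_nat kI.
apply: le_trans (decoupling J _) _; rewrite exchange_expect.
apply: expect_le => // y'.
apply: (@le_trans _ _ (expect (fun y => delta + 2 / #|I|%:R * N0 y y'))); last first.
  rewrite expectD expectZ expect_cst.
  apply: (@le_trans _ _ (delta + 2 / #|I|%:R * (#|I|%:R * delta))).
    by rewrite lerD2l; apply: ler_wpM2l => //; rewrite divr_ge0 ?ler0n.
  by rewrite mulrA divfK ?gt_eqF //; lra.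
apply: le_expect => // y; apply: expect_le => // x'.
have N00 : 0 <= N0 y y' by apply: sumr_ge0 => i _; rewrite ler0n.
(* Either more than half of the coefficients vanish, and Markov's term alone
   exceeds 1, or the linear inequality applies. *)
have [Nbig|Nsmall] := leP #|I|%:R (2 * N0 y y').
  apply: le_trans (prob_le1 _) _.
  have : 1 <= 2 / #|I|%:R * N0 y y' by rewrite mulrAC ler_pdivlMr // mul1r.
  lra.
have lt0 : 0 <= 2 / #|I|%:R * N0 y y' by rewrite mulr_ge0 // divr_ge0 // ltW.
apply: (@le_trans _ _ delta); last by rewrite lerDl.
pose s i := if i \in J then 0 else r i y - r i y'.
pose S := [set i in I | r i y != r i y'].
apply: le_trans (@littlewood_offord_le s (\sum_(i in x') s i) tau delta S d0 _ _ _).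
- apply: prob_sub => // x /and4P[/eqP q1 /eqP q2 /eqP q3 /eqP q4].
  rewrite -subr_eq0.
  pose X i : R := (i \in x)%:R - (i \in x')%:R.
  pose Y i : R := (i \in y)%:R - (i \in y')%:R.
  pose D i j : R := if (i \notin J) && (j \in J) then X i * Y j else 0.
  have sumX (f : T -> R) (z : {set T}) : \sum_(i in z) f i = \sum_i f i * (i \in z)%:R.
    by rewrite big_mkcond; apply: eq_bigr => i _; case: ifP; rewrite ?mulr1 ?mulr0.
  (* The alternating sum of the quadratic form over the four corners. *)
  have E : \sum_i \sum_j a i j * (D i j + D j i) = 0.
    transitivity (c - c - (c - c)); last by rewrite !subrr.
    rewrite -{1}q1 -{1}q2 -{1}q3 -{1}q4 -!sumrB; apply: eq_bigr => i _.
    rewrite -!sumrB; apply: eq_bigr => j _.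
    by rewrite !in_splice /D /X /Y; case: (i \in J); case: (j \in J) => /=; ring.
  have E2 : \sum_i \sum_j a i j * D i j = \sum_(i in x) s i - \sum_(i in x') s i.
    rewrite !sumX -sumrB; apply: eq_bigr => i _; rewrite -mulrBr -/(X i).
    rewrite /s /D; case: (i \in J) => /=.
      by rewrite mul0r big1 // => j _; rewrite mulr0.
    rewrite /r !sumX -sumrB mulr_suml; apply: eq_bigr => j _.
    by rewrite -mulrBr -/(Y j) /aJ; case: (j \in J) => /=; ring.
  rewrite -E2.
  have : 2 * (\sum_i \sum_j a i j * D i j) = 0.
    rewrite -[RHS]E; transitivity (\sum_i \sum_j a i j * D i j + \sum_i \sum_j a i j * D j i).
      rewrite mulr_natl mulr2n; congr (_ + _); rewrite exchange_big /=.
      by apply: eq_bigr => i _; apply: eq_bigr => j _; rewrite asym.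
    rewrite -big_split; apply: eq_bigr => i _; rewrite -big_split /=.
    by apply: eq_bigr => j _; rewrite mulrDr.
  by move/eqP; rewrite mulf_eq0 pnatr_eq0.
- move=> i; rewrite inE => /andP[iI ri]; rewrite /s.
  by rewrite (disjointFr dIJ iI) subr_eq0.
- by move=> i; rewrite inE => /andP[iI _]; apply: tauIJ; rewrite inE iI.
have SI : #|I|%:R = N0 y y' + #|S|%:R :> R.
  rewrite -sum1_card natr_sum -[#|S|]sum1_card natr_sum /N0.
  rewrite [X in _ + X](eq_bigl (fun i => (i \in I) && (r i y != r i y'))); last by move=> i; rewrite inE.
  by rewrite big_mkcondr -big_split; apply: eq_bigr => i _ /=; case: eqP => _ /=; rewrite ?addr0 ?add0r.
have : tau * #|I|%:R <= 2 * (tau * #|S|%:R).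
  by rewrite mulrCA; apply: ler_wpM2l => //; lra.
move/(ler_wpM2l (sqr_ge0 delta)); lra.
Qed.

(** If the event forces the values of the coordinates in [D] once the others are
    known, each of them costs a factor [rho].  In the induction, the coordinate
    [e] is projected out: its two values cannot both realise the event. *)
Lemma prob_determined (rho : R) (D : {set T}) (B : pred {set T}) :
  (forall e, e \in D -> p e <= rho /\ 1 - p e <= rho) ->
  (forall x y, x :\: D = y :\: D -> B x -> B y -> x = y) ->
  prob B <= rho ^+ #|D|.
Proof.
move: {2}#|D| (erefl #|D|) => n; elim: n D B => [|n IHn] D B cD rhoD BD.
  by rewrite cD prob_le1.
have /card_gt0P[e eD] : (0 < #|D|)%N by rewrite cD.
have [pr qr] := rhoD e eD; have /andP[p0 p1] := p01 e.
have r0 : 0 <= rho by lra.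
pose B' x := B (e |: x) || B (x :\ e).
apply: (@le_trans _ _ (rho * prob B')).
  rewrite /prob (expect_coord e) -expectZ; apply: le_expect => x.
  rewrite /B'; case: (boolP (B (e |: x))) => B1; case: (boolP (B (x :\ e))) => B2 /=; try lra.
  have /setP/(_ e) : e |: x = x :\ e; last by rewrite setU11 setD11.
  apply: BD => //; apply/setP => c; rewrite !inE; case: (boolP (c \in D)) => //= cD'.
  by have [ce|//] := eqVneq c e; move: cD'; rewrite ce eD.
rewrite cD exprS; apply: ler_wpM2l => //.
have cDe : #|D :\ e| = n by move: cD; rewrite (cardsD1 e) eD => -[].
rewrite -cDe; apply: IHn => // [c|x y xy].
  by rewrite !inE => /andP[_ /rhoD].
have xye c : c \notin D :\ e -> (c \in x) = (c \in y).
  by move=> cD'; have /setP/(_ c) := xy; rewrite (in_setD x) (in_setD y) cD'.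
have fin (x' y' : {set T}) : (forall c, c != e -> (c \in x') = (c \in x)) ->
    (forall c, c != e -> (c \in y') = (c \in y)) -> B x' -> B y' -> x = y.
  move=> xx yy Bx By; have /setP E : x' = y'.
    apply: BD => //; apply/setP => c; rewrite !inE; case: (boolP (c \in D)) => //= cD'.
    have ce : c != e by apply: contraNneq cD' => ->.
    by rewrite xx ?yy // xye // !inE ce.
  apply/setP => c; have [->|ce] := eqVneq c e; first by rewrite xye // !inE eqxx.
  by rewrite -xx // -yy.
by case/orP => B1; case/orP => B2; apply: fin B1 B2 => c /negPf ce; rewrite !inE ce.
Qed.

End BernoulliSets.

(** * Push-forward along an injection *)

Section Pushforward.
Variables (R : realFieldType) (I T : finType) (phi : I -> T) (p : T -> R).
Hypothesis phi_inj : injective phi.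

Lemma expect_preim (f : {set I} -> R) :
  expect p (fun x => f (phi @^-1: x)) = expect (p \o phi) f.
Proof.
rewrite /expect (partition_big (fun x : {set T} => phi @^-1: x) xpredT) //=.
apply: eq_bigr => z _; rewrite (eq_bigr (fun x => bweight p x * f z)); last first.
  by move=> x /eqP->.
rewrite -mulr_suml; congr (_ * _).
(* The fibre of [z] is cut out by killing the forbidden choice at each [phi i];
   the coordinates off the image of [phi] then sum to 1. *)
pose F e := if [exists i, (phi i == e) && (i \notin z)] then 0 else p e.
pose G e := if [exists i, (phi i == e) && (i \in z)] then 0 else 1 - p e.
have exE i (P : pred I) : [exists j, (phi j == phi i) && P j] = P i.
  apply/existsP/idP => [[j /andP[/eqP/phi_inj->]]//|Pi].
  by exists i; rewrite eqxx.
transitivity (\prod_e (F e + G e)).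
  rewrite -sum_sets_prod big_mkcond; apply: eq_bigr => x _.
  case: ifP => [/eqP xz|/negbT].
    apply: eq_bigr => e _; rewrite /F /G; case: ifP => ex; case: ifP => //.
    - by case/existsP => i /andP[/eqP ie]; rewrite -xz inE ie ex.
    - by case/existsP => i /andP[/eqP ie]; rewrite -xz inE ie ex.
  move=> /eqP/setP xz; have [i iz] : exists i, (phi i \in x) != (i \in z).
    apply/existsP; apply: contraT; rewrite negb_exists => /forallP h; case: xz => i.
    by rewrite inE; apply/eqP; rewrite -[_ == _]negbK.
  rewrite (bigD1 (phi i)) //= /F /G; case: ifP iz => _; rewrite (exE i) /=.
    by case: (i \in z) => //; rewrite mul0r.
  by case: (i \in z) => //; rewrite mul0r.
rewrite (bigID (mem (phi @: setT))) /= [X in _ * X]big1 ?mulr1; last first.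
  move=> e /negP ecod.
  have h (P : pred I) : [exists i, (phi i == e) && P i] = false.
    by apply/existsP => -[i /andP[/eqP ie _]]; apply: ecod; rewrite -ie imset_f.
  by rewrite /F /G !h addrC subrK.
rewrite big_imset /=; last by move=> i j _ _ /phi_inj.
rewrite big_mkcond; apply: eq_bigr => i _; rewrite inE /F /G (exE i) (exE i).
by case: (i \in z); rewrite ?addr0 ?add0r.
Qed.

End Pushforward.

(** * Sparse near-kernel vectors *)

Lemma row_basis_set (F : fieldType) m n (N : 'M[F]_(m, n)) :
  exists2 B : {set 'I_m}, (#|B| <= \rank N)%N &
    forall v : 'cV_n, (forall i, i \in B -> (N *m v) i 0 = 0) -> N *m v = 0.
Proof.
exists [set maxrankfun N k | k : 'I_(\rank N)].
  by rewrite -[leqRHS]card_ord leq_imset_card.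
move=> v Bv; have /submxP[D ND] : (N <= rowsub (maxrankfun N) N)%MS by rewrite eq_maxrowsub.
rewrite ND -mulmxA [X in D *m X](_ : _ = 0) ?mulmx0 //.
apply/matrixP => k l; rewrite [l]ord1 !mxE.
rewrite -[RHS](Bv (maxrankfun N k)) ?imset_f // mxE.
by apply: eq_bigr => j _; rewrite !mxE.
Qed.

Lemma rank_col_support (F : fieldType) m n (N : 'M[F]_(m, n)) (T : {set 'I_n}) :
  (forall i j, j \notin T -> N i j = 0) -> (\rank N <= #|T|)%N.
Proof.
move=> NT; pose f (k : 'I_#|T|) := enum_val k.
have -> : N = colsub f N *m \matrix_(k, j) (f k == j)%:R.
  apply/matrixP => i j; rewrite !mxE.
  have [jT|jT] := boolP (j \in T); last first.
    rewrite NT // big1 // => k _; rewrite !mxE; case: eqP => [kj|]; last by rewrite mulr0.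
    by move: jT; rewrite -kj enum_valP.
  rewrite (bigD1 (enum_rank_in jT j)) //= !mxE /f enum_rankK_in // eqxx mulr1.
  rewrite big1 ?addr0 // => k kj; rewrite !mxE; case: eqP => [kj'|]; last by rewrite mulr0.
  by case/eqP: kj; apply: enum_val_inj; rewrite enum_rankK_in.
exact: mulmx_max_rank.
Qed.

Section RandomMatrix.
Variables (R : realFieldType) (n : nat).
Implicit Types (x y : {set {set 'I_n}}) (M : 'M[R]_n) (u v z : 'cV[R]_n).

(** The distance matrix of the graph with edge set [x], if its diameter is at
    most two. *)
Definition dist2_mx x : 'M[R]_n :=
  \matrix_(i, j) (if i == j then 0 else 2 - ([set i; j] \in x)%:R).

(** Putting the supports of both [u] and [M *m u] inside one small set covers at
    once sparse kernel vectors, sparse columns of an inverse matrix (for which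
    [M *m u] is a basis vector), and the passage from [M] to [M] with one row and
    one column erased. *)
Definition sparse_defect (s : nat) M : Prop :=
  exists T : {set 'I_n}, (#|T| <= s)%N /\ exists u,
    [/\ u != 0, forall j, j \notin T -> u j 0 = 0 & forall i, i \notin T -> (M *m u) i 0 = 0].

(** Sets of vertices that are not pairs are junk coordinates; they get
    probability [0]. *)
Definition edge_prob (p : R) (e : {set 'I_n}) : R := if e \in vpairs n then p else 0.

Variable p : R.
Hypothesis p01 : 0 <= p <= 1.

Lemma edge_prob01 e : 0 <= edge_prob p e <= 1.
Proof. by rewrite /edge_prob; case: ifP => // _; rewrite lexx ler01. Qed.

Definition small_sets (s : nat) : {set {set 'I_n}} := [set T : {set 'I_n} | (#|T| <= s)%N].

(** A version of [sparse_defect] that can be charged to independent edges.  The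
    rows in [B] already determine the kernel of the submatrix with columns [T]
    and rows off [T], so a kernel vector [u] can be computed from the edges
    between [B] and [T] alone; for a row [i] outside [B] and [T], the equation
    [(M *m u) i 0 = 0] then forces the status of the edge from [i] to [j0],
    where [u] does not vanish. *)
Definition pinned_kernel (T B : {set 'I_n}) (j0 : 'I_n) M : Prop :=
  (exists u, [/\ u j0 0 != 0, forall j, j \notin T -> u j 0 = 0 &
     forall i, i \notin T -> (M *m u) i 0 = 0]) /\
  (forall v, (forall j, j \notin T -> v j 0 = 0) ->
     (forall i, i \in B :\: T -> (M *m v) i 0 = 0) ->
     forall i, i \notin T -> (M *m v) i 0 = 0).

Lemma sparse_defect_pinned s M : sparse_defect s M ->
  exists T B j0, [/\ T \in small_sets s, B \in small_sets s, j0 \in T & pinned_kernel T B j0 M].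
Proof.
move=> [T [Ts [u [u0 uT Mu]]]].
have /cV0Pn[j0 uj0] := u0.
pose N := \matrix_(i, j) (if (i \notin T) && (j \in T) then M i j else 0).
have NM v i : (forall j, j \notin T -> v j 0 = 0) -> i \notin T -> (N *m v) i 0 = (M *m v) i 0.
  move=> vT iT; rewrite !mxE; apply: eq_bigr => j _; rewrite !mxE iT /=.
  by case: ifPn => // /vT->; rewrite !mulr0.
have [B rB BN] := row_basis_set N.
have rN : (\rank N <= #|T|)%N.
  by apply: rank_col_support => i j jT; rewrite mxE (negPf jT) andbF.
exists T, B, j0; split; rewrite ?inE //.
- exact: leq_trans rB (leq_trans rN Ts).
- by apply: contraNT uj0 => /uT->.
split; first by exists u.
move=> v vT vB i iT; rewrite -NM // BN ?mxE // => k kB.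
have [kT|kT] := boolP (k \in T); last by rewrite NM // vB // inE kT.
by rewrite !mxE big1 // => j _; rewrite !mxE kT mul0r.
Qed.

(** The edges from [j0] to the vertices outside [T] and [B] are determined by all
    the others, so that [prob_determined] applies. *)
Lemma prob_pinned_kernel rho (T B : {set 'I_n}) j0 :
  p <= rho -> 1 - p <= rho -> j0 \in T ->
  prob (edge_prob p) (fun x => `[< pinned_kernel T B j0 (dist2_mx x) >])
    <= rho ^+ #|~: (T :|: B)|.
Proof.
move=> pr qr j0T; set W := ~: _.
have WT i : i \in W -> i \notin T by rewrite !inE negb_or => /andP[].
have phi_inj : {in W &, injective (fun i => [set i; j0])}.
  move=> i k iW kW /setP/(_ i); rewrite !inE eqxx /= => /esym/orP[/eqP//|/eqP ij].
  by move: (WT i iW); rewrite ij j0T.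
pose D := [set [set i; j0] | i in W].
have <- : #|D| = #|W| by rewrite card_in_imset.
have DE i j : i \notin T -> j \in T -> [set i; j] \in D -> i \in W /\ j = j0.
  move=> iT jT /imsetP[k kW /setP E].
  have /set2P[jk|->] : j \in [set k; j0] by rewrite -E set22.
    by case/negP: (WT k kW); rewrite -jk.
  have /set2P[->//|ij] : i \in [set k; j0] by rewrite -E set21.
  by case/negP: iT; rewrite ij.
apply: (prob_determined edge_prob01) => [e /imsetP[i iW ->]|x y xy].
  rewrite /edge_prob inE cards2 (_ : i != j0) //.
  by apply: contraNneq (WT i iW) => ->.
have xyD e : e \notin D -> (e \in x) = (e \in y).
  by move=> eD; have /setP/(_ e) := xy; rewrite (in_setD x) (in_setD y) eD.
have Mxy i j : i \notin T -> j \in T -> ~~ ((i \in W) && (j == j0)) ->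
    dist2_mx x i j = dist2_mx y i j.
  move=> iT jT nD; rewrite !mxE; case: ifP => // _; rewrite xyD //.
  by apply: contra nD => /DE[]// -> ->; rewrite eqxx.
move=> /asboolP[[u [uj0 uT xu]] _] /asboolP[_ yB].
have xyu i : i \notin T -> i \notin W -> (dist2_mx x *m u) i 0 = (dist2_mx y *m u) i 0.
  move=> iT iW; rewrite [LHS]mxE [RHS]mxE; apply: eq_bigr => j _.
  have [jT|/uT->] := boolP (j \in T); last by rewrite !mulr0.
  by rewrite Mxy // (negPf iW).
(* [u] comes from [x], but the rows in [B] are the same in [x] and [y], hence
   [u] is also a kernel vector for [y]. *)
have yu i : i \notin T -> (dist2_mx y *m u) i 0 = 0.
  apply: yB => // k; rewrite inE => /andP[kT kB].
  by rewrite -xyu // ?xu // !inE kB orbT.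
apply/setP => e; have [/imsetP[i iW ->]|/xyD//] := boolP (e \in D).
have iT := WT i iW.
have : (dist2_mx x *m u) i 0 - (dist2_mx y *m u) i 0 = 0 by rewrite xu // yu // subrr.
rewrite [X in X - _]mxE [X in _ - X]mxE -sumrB (bigD1 j0) //= big1 ?addr0; last first.
  move=> j jj0; have [jT|/uT->] := boolP (j \in T); last by rewrite !mulr0 subrr.
  by rewrite Mxy // ?subrr // (negPf jj0) andbF.
move/eqP; rewrite -mulrBl mulf_eq0 (negPf uj0) orbF !mxE.
have -> : (i == j0) = false by apply: contraNF iT => /eqP->.
by case: (_ \in x); case: (_ \in y) => //= /eqP; lra.
Qed.

(** Union bound over the support, the row basis and the pivot [j0]. *)
Lemma prob_sparse_defect rho s : p <= rho -> 1 - p <= rho -> rho <= 1 ->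
  prob (edge_prob p) (fun x => `[< sparse_defect s (dist2_mx x) >])
    <= n%:R * #|small_sets s|%:R ^+ 2 * rho ^+ (n - s.*2).
Proof.
move=> pr qr r1; have r0 : 0 <= rho by have /andP[? ?] := p01; lra.
pose P (t : {set 'I_n} * {set 'I_n} * 'I_n) :=
  [&& t.1.1 \in small_sets s, t.1.2 \in small_sets s & t.2 \in t.1.1].
pose E (t : {set 'I_n} * {set 'I_n} * 'I_n) x :=
  `[< pinned_kernel t.1.1 t.1.2 t.2 (dist2_mx x) >].
apply: le_trans (@prob_union_le _ _ _ edge_prob01 _ P _ E _) _.
  move=> x /asboolP/sparse_defect_pinned[T [B [j0 [Ts Bs j0T pk]]]].
  by exists (T, B, j0); [rewrite /P /= Ts Bs|apply/asboolP].
apply: (@le_trans _ _ (\sum_(t | P t) rho ^+ (n - s.*2))).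
  apply: ler_sum => -[[T B] j0] /and3P[/= Ts Bs j0T].
  apply: le_trans (prob_pinned_kernel _ pr qr j0T) _.
  apply: ler_wiXn2l => //.
  rewrite !inE in Ts Bs.
  rewrite /= leq_subLR -[leqLHS]card_ord -(cardsC (T :|: B)) leq_add2r -addnn.
  by apply: leq_trans (leq_card_setU T B) _; apply: leq_add.
rewrite sumr_const -[leLHS]mulr_natl; apply: ler_wpM2r; first exact: exprn_ge0.
rewrite -natrX -natrM ler_nat.
have -> : (n * #|small_sets s| ^ 2 = #|setX (setX (small_sets s) (small_sets s)) [set: 'I_n]|)%N.
  by rewrite !cardsX cardsT card_ord mulnC mulnn.
apply: subset_leq_card; apply/fintype.subsetP => -[[T B] j0] /and3P[/= Ts Bs j0T].
by rewrite !inE /= in Ts Bs *; rewrite Ts Bs.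
Qed.

End RandomMatrix.

(** * Bordering a fixed symmetric matrix by a random column *)

Section Bordering.
Variables (R : realFieldType) (n : nat).
Implicit Types (x y : {set {set 'I_n}}) (M Q : 'M[R]_n) (u v z : 'cV[R]_n).

Definition border_col (i : 'I_n) (X : {set 'I_n}) : 'cV[R]_n :=
  \col_j (if j == i then 0 else 2 - (j \in X)%:R).

(** The symmetric matrix obtained from [Q] by adjoining the column [border_col i X]
    and a zero on the diagonal has a kernel vector with last entry [-1].  The
    size stays [n], because the vertex [i] is kept as an inert coordinate of [Q]:
    its row and column are those of the identity matrix. *)
Definition border_singular Q i (X : {set 'I_n}) : Prop :=
  exists z, Q *m z = border_col i X /\ (border_col i X)^T *m z = 0.

(** The absence of sparse near-kernel vectors, restricted to what depends only on
    the matrix without the row and column [i]. *)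
Definition border_good (s : nat) Q i : Prop :=
  forall u (T : {set 'I_n}), i \in T -> (#|T| <= s)%N -> u != 0 -> u i 0 = 0 ->
    (forall j, j \notin T -> u j 0 = 0) -> exists2 k, k \notin T & (Q *m u) k 0 != 0.

Lemma mulmx_colE m (N : 'M[R]_(m, n)) u i : (N *m u) i 0 = \sum_j N i j * u j 0.
Proof. by rewrite mxE. Qed.

Variables (q : 'I_n -> R) (i : 'I_n) (tau delta eps : R) (h : nat).
Hypotheses (q01 : forall j, 0 <= q j <= 1).
Hypothesis tau_q : forall j, j != i -> tau <= q j * (1 - q j).
(* [delta] bounds linear forms; [3 * delta <= eps ^+ 4] turns the fourth-power
   bound for quadratic forms into [eps]. *)
Hypotheses (tau0 : 0 <= tau) (d0 : 0 <= delta) (e0 : 0 <= eps) (de : delta <= eps)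
  (de4 : 3 * delta <= eps ^+ 4) (dh : 2 <= delta ^+ 2 * (tau * h%:R)) (hn : (h < n)%N).

(** If [Q] is singular, pairing its kernel vector [u] with the random column [v]
    gives zero, and [u] has many nonzero entries: a linear Littlewood-Offord
    event.  If [Q] is invertible, [v] is isotropic for the inverse [A] of [Q],
    all of whose columns but the [i]-th have many nonzero entries: a quadratic
    Littlewood-Offord event. *)
Lemma prob_border_singular Q :
  Q^T = Q -> (forall j, Q i j = (i == j)%:R) -> border_good (h.*2.+1) Q i ->
  prob q (fun X => `[< border_singular Q i X >]) <= eps.
Proof.
move=> Qsym Qi Qgood.
have Qui u : (Q *m u) i 0 = u i 0.
  rewrite mxE (bigD1 i) //= Qi eqxx mul1r big1 ?addr0 // => j ji.
  by rewrite Qi eq_sym (negPf ji) mul0r.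
have d2 := sqr_ge0 delta.
have [Qu|] := boolP (Q \in unitmx); last first.
  rewrite unitmxE unitfE negbK => /det0P[w w0 wQ].
  have [u u0 Qu] : exists2 u : 'cV[R]_n, u != 0 & Q *m u = 0.
    exists w^T; first by rewrite trmx_eq0.
    by rewrite -Qsym -trmx_mul wQ trmx0.
  have ui : u i 0 = 0 by rewrite -Qui Qu mxE.
  pose S := [set j | u j 0 != 0].
  have hS : (h <= #|S|)%N.
    rewrite leqNgt; apply/negP => Sh.
    have [||j|k _] := Qgood u (i |: S) _ _ u0 ui; rewrite ?setU11 //.
    - apply: leq_trans (leq_card_setU [set i] S) _.
      by rewrite cards1 add1n ltnS -addnn (leq_trans (ltnW Sh)) ?leq_addr.
    - by rewrite !inE negb_or => /andP[_]; rewrite negbK => /eqP.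
    - by rewrite Qu mxE eqxx.
  apply: le_trans de.
  apply: (@le_trans _ _ (prob q (fun X => \sum_(j in X) u j 0 == \sum_j 2 * u j 0))).
    apply: prob_sub => // X /asboolP[z [Qz _]].
    have : u^T *m border_col i X = 0 by rewrite -Qz mulmxA -{1}Qsym -trmx_mul Qu trmx0 mul0mx.
    move/matrixP/(_ 0 0); rewrite !mxE => E; rewrite eq_sym -subr_eq0 -[X in _ == X]E.
    apply/eqP; rewrite [X in _ - X]big_mkcond -sumrB; apply: eq_bigr => j _; rewrite !mxE.
    by case: eqVneq => [->|_]; [rewrite ui|]; case: (_ \in X) => /=; rewrite ?mulr1n ?mulr0n; ring.
  apply: (@littlewood_offord_le _ _ q q01 _ _ tau delta S) => // [j|j|].
  - by rewrite inE.
  - by rewrite inE => uj; apply: tau_q; apply: contraNneq uj => ->; rewrite ui.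
  - apply: (@le_trans _ _ 2); first by rewrite ler1n.
    by apply: le_trans dh _; apply: ler_wpM2l => //; apply: ler_wpM2l => //; rewrite ler_nat.
pose A : 'M[R]_n := invmx Q.
have Asym : A^T = A by rewrite trmx_inv Qsym.
have QA : Q *m A = 1%:M by rewrite mulmxV.
have AiE j : A i j = (i == j)%:R.
  by have := Qui (col j A); rewrite {1}colE mulmxA QA mul1mx !mxE eqxx andbT => <-.
have AsE j k : A j k = A k j by rewrite -[in LHS]Asym mxE.
(* The entry of [A] at [(i, i)] is erased since the entry [i] of the column is
   not of the form [2 - (i \in X)%:R]. *)
pose a j k := if (j == i) || (k == i) then 0 else A j k.
(* [I] has only [h] elements whereas each column of [A] has at least [2 * h]
   nonzero entries, so at least [h] of these lie outside [I]. *)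
have [I Ii cI] : exists2 I : {set 'I_n}, i \notin I & #|I| = h.
  exists [set j in take h (enum [set~ i])].
    by rewrite inE; apply/negP => /mem_take; rewrite mem_enum !inE eqxx.
  rewrite cardsE (card_uniqP _) ?take_uniq ?enum_uniq // size_takel // -cardE.
  by rewrite cardsC1 card_ord -ltnS (leq_trans hn) // leqSpred.
pose J := ~: (i |: I).
have rowJ j : j \in I -> (h <= #|[set k in J | a j k != 0%R]|)%N.
  move=> jI; have ji : j != i by apply: contraNneq Ii => <-.
  rewrite leqNgt; apply/negP => cJ.
  pose S := [set k in J | a j k != 0].
  pose u := col j A.
  have ui : u i 0 = 0 by rewrite mxE AiE eq_sym (negPf ji).
  have Qcol : Q *m u = delta_mx j 0 by rewrite /u colE mulmxA QA mul1mx.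
  have u0 : u != 0.
    apply: contraTneq isT => u0; move/matrixP/(_ j 0): Qcol.
    by rewrite u0 mulmx0 !mxE !eqxx => /esym/eqP; rewrite oner_eq0.
  have [||k|k] := Qgood u (i |: (I :|: S)) _ _ u0 ui; rewrite ?setU11 //.
  - apply: leq_trans (leq_card_setU [set i] (I :|: S)) _.
    rewrite cards1 add1n ltnS -addnn (leq_trans (leq_card_setU I S)) //.
    by rewrite cI leq_add2l ltnW.
  - rewrite !inE => /norP[ki /norP[kI]]; rewrite (negPf ki) (negPf kI) /= /a (negPf ji) (negPf ki) /= negbK.
    by rewrite !mxE AsE => /eqP.
  - move=> kT; rewrite Qcol mxE eqxx andbT.
    case: (eqVneq k j) => [kj _|_]; last by rewrite eqxx.
    by case/negP: kT; rewrite kj !inE jI orbT.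
rewrite -(@ler_pXn2r _ 4) ?nnegrE ?prob_ge0 //; apply: le_trans de4.
apply: (@le_trans _ _ (prob q (fun X =>
   \sum_j \sum_k a j k * ((2 - (j \in X)%:R) * (2 - (k \in X)%:R)) == 0) ^+ 4)).
  rewrite ler_pXn2r ?nnegrE ?prob_ge0 //; apply: prob_sub => // X /asboolP[z [Qz vz]].
  have zE : z = A *m border_col i X by rewrite -Qz mulKmx.
  move/matrixP/(_ 0 0): vz; rewrite zE [RHS]mxE mulmx_colE => vAv.
  apply/eqP; rewrite -[RHS]vAv; apply: eq_bigr => j _; rewrite mulmx_colE mulr_sumr; apply: eq_bigr => k _.
  rewrite !mxE /a; case: (eqVneq j i) => [_|_] /=; first by rewrite !mul0r.
  by case: (eqVneq k i) => [_|_] /=; [rewrite mulr0 mul0r mulr0|ring].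
apply: (@quadratic_littlewood_offord _ _ q q01 a (fun=> 2) 0 tau delta I J h) => //.
- by move=> j k; rewrite /a orbC AsE.
- by rewrite disjoints_subset /J setCK subsetUr.
- move=> j jIJ; apply: tau_q; move: jIJ; rewrite !inE.
  by case/orP => [jI|/norP[]//]; apply: contraNneq Ii => <-.
- by apply: le_trans dh; rewrite ler1n.
- by rewrite cI.
Qed.

End Bordering.

(** * Singularity of the random matrix *)

Section Singularity.
Variables (R : realFieldType) (n : nat) (p tau delta eps : R) (h : nat).
Implicit Types (x y : {set {set 'I_n}}) (u v z : 'cV[R]_n).
Hypotheses (p01 : 0 <= p <= 1) (tau0 : 0 <= tau) (tau_p : tau <= p * (1 - p))
  (d0 : 0 <= delta) (e0 : 0 <= eps) (de : delta <= eps)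
  (de4 : 3 * delta <= eps ^+ 4) (dh : 2 <= delta ^+ 2 * (tau * h%:R)) (hn : (h < n)%N).

Let s := h.*2.+1.

Definition spread_kernel_at i x : Prop :=
  ~ sparse_defect s (dist2_mx R x) /\ exists z, z i 0 = -1 /\ dist2_mx R x *m z = 0.

Lemma set2_inj (T : finType) (i : T) : injective (fun j => [set i; j]).
Proof.
move=> j k E; have /set2P[ji|//] : j \in [set i; k] by rewrite -E set22.
by have /set2P[ki|->//] : k \in [set i; j]; [rewrite E set22|rewrite ji ki].
Qed.

(** Condition on the edges avoiding [i].  The erased matrix [Q] is then fixed, the
    neighbourhood of [i] is a random subset independent of it, and
    [prob_border_singular] applies. *)
Lemma prob_spread_kernel_at i :
  prob (edge_prob p) (fun x => `[< spread_kernel_at i x >]) <= eps.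
Proof.
have ep01 := @edge_prob01 R n p p01.
pose K := [set e : {set 'I_n} | i \in e].
rewrite /prob -(expect_splice _ K) exchange_expect; apply: expect_le => // y.
pose M x := dist2_mx R (splice K x y).
pose star x := (fun j => [set i; j]) @^-1: x.
pose Q : 'M[R]_n := \matrix_(a, b)
  (if (a == i) || (b == i) then (a == b)%:R else dist2_mx R y a b).
have MQ x a b : a != i -> b != i -> M x a b = Q a b.
  move=> ai bi; rewrite !mxE (negPf ai) (negPf bi) in_splice !inE.
  by rewrite ![i == _]eq_sym (negPf ai) (negPf bi).
have Mcol x a : M x a i = border_col R i (star x) a 0.
  by rewrite !mxE; case: eqP => // _; rewrite in_splice !inE eqxx orbT setUC.
have Mrow x a : M x i a = border_col R i (star x) a 0.
  by rewrite -Mcol !mxE eq_sym setUC.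
(* The absence of sparse defects is part of the event; one realisation [x0]
   transfers it to [Q], which does not depend on [x0]. *)
have [[x0 /asboolP[good _]]|none] := pselect (exists x0, `[< spread_kernel_at i (splice K x0 y) >]);
  last first.
  by apply: expect_le => // x; case: asboolP => // F; case: none; exists x; apply/asboolP.
apply: (@le_trans _ _ (prob (edge_prob p) (fun x => `[< border_singular Q i (star x) >]))).
  apply: prob_sub => // x /asboolP[_ [z [zi Mz]]]; apply/asboolP.
  have row a : \sum_(b | b != i) M x a b * z b 0 = M x a i.
    have /matrixP/(_ a 0) := Mz; rewrite [RHS]mxE mulmx_colE (bigD1 i) //= zi mulrN1.
    by move/eqP; rewrite addrC subr_eq0 => /eqP.
  exists (\col_j (if j == i then 0 else z j 0)).
  have sum0 (f : 'I_n -> R) : \sum_b f b * (\col_j (if j == i then 0 else z j 0) : 'cV_n) b 0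
      = \sum_(b | b != i) f b * z b 0.
    rewrite (bigD1 i) //= mxE eqxx mulr0 add0r.
    by apply: eq_bigr => b bi; rewrite mxE (negPf bi).
  split; apply/matrixP => a b; rewrite [b]ord1 mulmx_colE sum0.
    have [->|ai] := eqVneq a i.
      rewrite big1 ?mxE ?eqxx // => c ci; rewrite mxE eqxx /= eq_sym (negPf ci).
      by rewrite mul0r.
    by rewrite -Mcol -row; apply: eq_bigr => c ci; rewrite MQ.
  transitivity (M x i i); last by rewrite !mxE eqxx.
  by rewrite -row; apply: eq_bigr => c _; rewrite Mrow mxE [a]ord1.
rewrite /prob (expect_preim _ (@set2_inj _ i) (fun X => (`[< border_singular Q i X >])%:R)).
have qi j : j != i -> edge_prob p [set i; j] = p.
  by move=> ji; rewrite /edge_prob inE cards2 [i == j]eq_sym ji.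
apply: (@prob_border_singular _ _ _ i tau delta eps h) => //.
- by move=> j /=; apply: ep01.
- by move=> j ji /=; rewrite qi.
- by apply/matrixP => a b; rewrite !mxE orbC (eq_sym b a) (setUC [set b]).
- by move=> j; rewrite mxE eqxx.
- move=> u T iT Ts u0 ui uT; apply: contrapT => none; apply: good; exists T; split=> //.
  exists u; split=> // k kT; apply/eqP/negPn/negP => Mk; apply: none; exists k => //.
  have ki : k != i by apply: contraNneq kT => ->.
  move: Mk; congr (~~ (_ == _)); rewrite !mulmx_colE; apply: eq_bigr => b _.
  have [->|bi] := eqVneq b i; first by rewrite ui !mulr0.
  by rewrite -(MQ x0).
Qed.

(** Double counting: if the matrix is singular without sparse defect, a kernel
    vector has more than [s] nonzero entries, and rescaling it shows that
    [spread_kernel_at i] holds for more than [s] indices [i].  Since each of these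
    [n] events has probability at most [eps], Markov's inequality concludes. *)
Lemma prob_det_dist2 :
  prob (edge_prob p) (fun x => \det (dist2_mx R x) == 0) <=
  prob (edge_prob p) (fun x => `[< sparse_defect s (dist2_mx R x) >])
    + n%:R / s.+1%:R * eps.
Proof.
have ep01 := @edge_prob01 R n p p01.
pose A x := (\det (dist2_mx R x) == 0) && ~~ `[< sparse_defect s (dist2_mx R x) >].
apply: le_trans (@prob_or _ _ _ ep01 _ (fun x => `[< sparse_defect s (dist2_mx R x) >]) A _) _.
  by move=> x dx; rewrite /A dx; case: asboolP; [left|right].
rewrite lerD2l mulrAC ler_pdivlMr ?ltr0n // mulrC.
apply: (@le_trans _ _ (\sum_(i < n) prob (edge_prob p) (fun x => `[< spread_kernel_at i x >]))); last first.
  apply: le_trans (ler_sum _ (fun i _ => prob_spread_kernel_at i)) _.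
  by rewrite sumr_const card_ord mulr_natl.
rewrite -expect_sum -expectZ; apply: le_expect => // x.
case: (boolP (A x)) => [/andP[]|_]; last by rewrite mulr0 sumr_ge0 // => i _; rewrite ler0n.
rewrite -det_tr => /det0P[w w0 wM] /asboolP good; rewrite mulr1.
have [u u0 Mu] : exists2 u : 'cV[R]_n, u != 0 & dist2_mx R x *m u = 0.
  exists w^T; first by rewrite trmx_eq0.
  by rewrite -[dist2_mx R x]trmxK -trmx_mul wM trmx0.
pose T := [set i | u i 0 != 0].
have sT : (s < #|T|)%N.
  rewrite ltnNge; apply/negP => Ts; apply: good; exists T; split=> //; exists u; split=> // i.
    by rewrite inE negbK => /eqP.
  by rewrite Mu mxE.
apply: (@le_trans _ _ (#|T|%:R)); first by rewrite ler_nat.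
rewrite -sum1_card natr_sum [leLHS]big_mkcond; apply: ler_sum => i _.
case: ifP => [|_]; last by rewrite ler0n.
rewrite inE => ui; rewrite (_ : `[< _ >]) //; apply/asboolP; split=> //.
exists (- (u i 0)^-1 *: u); split; first by rewrite mxE mulNr mulVf.
by rewrite -scalemxAr Mu scaler0.
Qed.

End Singularity.

(** * Diameter two *)

Section AvoidPairs.
Variables (R : realFieldType) (T : finType) (p : T -> R).

Lemma prob_pair e f : e != f -> prob p (fun x => (e \in x) && (f \in x)) = p e * p f.
Proof.
move=> ef; rewrite -(prob_in p e) -(prob_in p f) /prob -(@expect_indep _ _ p [set e]).
- by apply: eq_expect => x; rewrite -natrM mulnb.
- by move=> x y; rewrite in_splice inE eqxx.
- by move=> x y; rewrite in_splice inE eq_sym (negPf ef).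
Qed.

(** The pairs [(e k, f k)] are pairwise disjoint, hence independent. *)
Lemma prob_avoid_pairs (I : eqType) (e f : I -> T) (r : R) (s : seq I) :
  uniq s -> injective e -> injective f ->
  {in s &, forall k l, e k != f l} ->
  {in s, forall k, p (e k) = r /\ p (f k) = r} ->
  prob p (fun x => all (fun k => ~~ ((e k \in x) && (f k \in x))) s) = (1 - r ^+ 2) ^+ size s.
Proof.
move=> us ie if_; elim: s us => [_ _ _|k s IHs /= /andP[ks us] ef pr].
  by rewrite /prob /= expect_cst expr0.
rewrite exprS -IHs //; last 2 first.
- by move=> a b As Bs; apply: ef; rewrite inE ?As ?Bs orbT.
- by move=> a As; apply: pr; rewrite inE As orbT.
have [pe pf] := pr k (mem_head _ _).
have efk : e k != f k by apply: ef; apply: mem_head.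
have <- : prob p (fun x => ~~ ((e k \in x) && (f k \in x))) = 1 - r ^+ 2.
  rewrite expr2 -{1}pe -pf -prob_pair // -[X in X - _](expect_cst p 1).
  apply/eqP; rewrite eq_sym subr_eq -expectD; apply/eqP; apply: eq_expect => x.
  by case: (_ && _); rewrite ?addr0 ?add0r.
rewrite /prob -(@expect_indep _ _ p [set e k; f k]).
- by apply: eq_expect => x; rewrite -natrM mulnb.
- by move=> x y; rewrite !in_splice !inE !eqxx orbT.
- move=> x y; congr (_ %:R); congr nat_of_bool; apply: eq_in_all => l ls.
  have kl : l != k by apply: contraNneq ks => <-.
  have [lK kK] : l \in k :: s /\ k \in k :: s by rewrite !inE eqxx ls orbT.
  rewrite !in_splice !inE (inj_eq ie) (inj_eq if_) (negPf kl) (negPf (ef _ _ lK kK)).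
  by rewrite eq_sym (negPf (ef _ _ kK lK)).
Qed.

End AvoidPairs.

Section Distance.
Variables (n : nat).
Implicit Types (x E : {set {set 'I_n}}).

Definition common_neighbours E : bool :=
  [forall i, forall j, (i != j) ==> [exists k, adj E i k && adj E k j]].

Lemma gdist_common_neighbours E i j : common_neighbours E ->
  gdist (adj E) i j = (if i == j then 0 else 2 - adj E i j)%N.
Proof.
move=> /forallP/(_ i)/forallP/(_ j)/implyP cn.
have w0 k : walk (adj E) 0 i k = (i == k).
  apply/walkP/eqP => [[s [/size0nil-> _ /= ->]]//|->]; by exists [::].
case: (eqVneq i j) cn => [<- _|ij /(_ isT)/existsP[k /andP[ik kj]]].
  have [_ /(_ 0)] := gdistP (connect0 (adj E) i).
  by rewrite w0 eqxx leqn0 => /(_ isT)/eqP.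
have cij : connect (adj E) i j by apply: connect_trans (connect1 ik) (connect1 kj).
have [wd mind] := gdistP cij; move: wd mind.
have w1 : walk (adj E) 1 i j = adj E i j.
  apply/walkP/idP => [[s [ss es ls]]|aij].
    by case: s ss es ls => [|a []] //= _ /andP[ia _] <-.
  by exists [:: j]; split=> //=; rewrite aij.
have w2 : walk (adj E) 2 i j by apply/walkP; exists [:: k; j]; rewrite /= ik kj.
case: (gdist _ _ _) => [|[|d]]; rewrite ?w0 ?w1 ?(negPf ij) // => wd mind.
  by rewrite wd.
have := mind 2 w2; have := mind 1%N; rewrite w1.
by case: (adj E i j) => [/(_ isT)|_]; case: d {wd mind}.
Qed.

Lemma connected_common_neighbours E : common_neighbours E -> gconnected (adj E).
Proof.
move=> cn; apply/forallP => i; apply/forallP => j.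
have [->|ij] := eqVneq i j; first exact: connect0.
move/forallP/(_ i)/forallP/(_ j)/implyP/(_ ij)/existsP: cn => [k /andP[ik kj]].
exact: connect_trans (connect1 ik) (connect1 kj).
Qed.

Lemma dist_mx_common_neighbours (R : realType) (C : 'M[R]_n) E :
  common_neighbours E -> dist_mx C E = dist2_mx R E.
Proof.
move=> cn; rewrite /dist_mx connected_common_neighbours //.
apply/matrixP => i j; rewrite !mxE gdist_common_neighbours //.
by case: eqP => // _; rewrite /adj natrB //; case: (_ \in _).
Qed.

Lemma gnp_probE (R : realType) (p : R) (A : pred {set {set 'I_n}}) :
  gnp_prob p A = prob (edge_prob p) (fun x => (x \subset vpairs n) && A x).
Proof.
rewrite /gnp_prob big_mkcond; apply: eq_bigr => x _; rewrite powersetE.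
case: (boolP (x \subset vpairs n)) => xV /=; last by rewrite mulr0.
case: (A x); last by rewrite mulr0.
rewrite mulr1 big_mkcond; apply: eq_bigr => e _; rewrite /edge_prob.
case: ifPn => // eV; rewrite subr0; case: ifP => // ex.
by case/negP: eV; apply: (fintype.subsetP xV).
Qed.

Lemma prob_no_common_neighbours (R : realFieldType) (p : R) : 0 <= p <= 1 ->
  prob (edge_prob p) (fun x => ~~ common_neighbours x)
    <= n%:R ^+ 2 * (1 - p ^+ 2) ^+ (n - 2).
Proof.
move=> p01; have ep01 := @edge_prob01 R n p p01.
pose P (t : 'I_n * 'I_n) := t.1 != t.2.
pose W (t : 'I_n * 'I_n) := enum (~: [set t.1; t.2]).
pose B t x := all (fun k => ~~ (([set t.1; k] \in x) && ([set t.2; k] \in x))) (W t).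
apply: le_trans (@prob_union_le _ _ _ ep01 _ P _ B _) _.
  move=> x; rewrite negb_forall => /existsP[i]; rewrite negb_forall => /existsP[j].
  rewrite negb_imply => /andP[ij no]; exists (i, j) => //.
  apply/allP => k _; apply: contraNN no => /andP[ik jk]; apply/existsP; exists k.
  by rewrite /adj ik setUC.
apply: (@le_trans _ _ (\sum_(t | P t) (1 - p ^+ 2) ^+ (n - 2))).
  apply: ler_sum => -[i j]; rewrite /P /= => ij.
  rewrite (@prob_avoid_pairs _ _ _ _ _ _ p) ?enum_uniq //; first last.
  - move=> k; rewrite mem_enum !inE negb_or => /andP[ki kj].
    by rewrite /edge_prob !inE !cards2 ![_ == k]eq_sym ki kj.
  - move=> k l; rewrite !mem_enum !inE !negb_or => /andP[ki kj] /andP[li lj].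
    apply: contraNneq ij => E; have /set2P[->|il] : i \in [set j; l] by rewrite -E set21.
      by rewrite /= eqxx.
    by rewrite il eqxx in li.
  - exact: set2_inj.
  - exact: set2_inj.
  rewrite -cardE; have := cardsC [set i; j]; rewrite cards2 ij card_ord => E.
  by rewrite (_ : (n - 2)%N = #|~: [set i; j]|) // -[X in (X - 2)%N]E addKn.
rewrite sumr_const -[leLHS]mulr_natl; apply: ler_wpM2r.
  by apply: exprn_ge0; have /andP[? ?] := p01; nra.
rewrite -natrX ler_nat (leq_trans (max_card _)) // card_prod card_ord mulnn //.
Qed.

End Distance.

(** * Limits *)

Local Open Scope classical_set_scope.
Local Open Scope ring_scope.

Section Asymptotics.
Variable R : realType.

Lemma natr_le_exp (a : R) n : 0 <= a -> n%:R * a <= (1 + a) ^+ n.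
Proof.
move=> a0; suff : 1 + n%:R * a <= (1 + a) ^+ n by lra.
elim: n => [|n IHn]; first by rewrite mul0r addr0 expr0.
have n0 : 0 <= n%:R * (a * a) by rewrite mulr_ge0 ?ler0n // mulr_ge0.
rewrite exprS; apply: le_trans (ler_wpM2l _ IHn); last by lra.
by rewrite -natr1; nra.
Qed.

Lemma geometric_small (C t e : R) : 0 <= C -> 0 <= t < 1 -> 0 < e ->
  exists N, forall n, (N <= n)%N -> C * t ^+ n <= e.
Proof.
move=> C0 /andP[t0 t1] e0.
have : (GRing.exp t : nat -> R) @ \oo --> (0 : R) by apply: cvg_expr; rewrite ger0_norm.
have eC : 0 < e / (C + 1) by rewrite divr_gt0 //; lra.
move/cvgrPdist_le/(_ _ eC) => [N _ HN]; exists N => n Nn.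
have := HN n Nn; rewrite /= sub0r normrN ger0_norm ?exprn_ge0 //.
rewrite ler_pdivlMr; last by lra.
have := exprn_ge0 n t0; set u := _ ^+ _; nra.
Qed.

(** Polynomial factors in [n], and the number of small subsets, are each absorbed
    by a power of [1 + a] that a geometric decay of ratio [r] still beats. *)
Lemma exp_gap (r : R) : 0 <= r < 1 -> exists2 a, 0 < a <= 1 & r * (1 + a) ^+ 3 < 1.
Proof.
move=> /andP[r0 r1]; exists ((1 - r) / 8); first by apply/andP; split; lra.
set a := _ / 8; have a0 : 0 < a by rewrite /a; lra.
have a1 : a <= 1 by rewrite /a; lra.
have a3 : (1 + a) ^+ 3 <= 1 + 7 * a.
  have : a * a <= a by nra.
  have : a * (a * a) <= a by nra.
  by rewrite !exprS expr0 mulr1; lra.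
apply: le_lt_trans (ler_wpM2l r0 a3) _; rewrite /a; nra.
Qed.

(** The generating function of subsets by cardinality, keeping the terms of
    cardinality at most [s]. *)
Lemma card_small_sets (eta : R) n s : 0 <= eta <= 1 ->
  #|small_sets n s|%:R * eta ^+ s <= (1 + eta) ^+ n.
Proof.
move=> /andP[eta0 eta1].
have -> : (1 + eta) ^+ n = \sum_(T : {set 'I_n}) eta ^+ #|T|.
  transitivity (\prod_(i : 'I_n) (eta + 1)); first by rewrite prodr_const card_ord addrC.
  rewrite -sum_sets_prod; apply: eq_bigr => T _.
  by rewrite -big_mkcond /= prodr_const.
rewrite [leRHS](bigID (mem (small_sets n s))) /=.
apply: (@le_trans _ _ (\sum_(T in small_sets n s) eta ^+ #|T|)).
  rewrite mulr_natl -sumr_const; apply: ler_sum => T; rewrite inE => Ts.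
  exact: ler_wiXn2l.
by rewrite lerDl sumr_ge0 // => T _; rewrite exprn_ge0.
Qed.

Lemma diameter_error_small (p e : R) : 0 < p < 1 -> 0 < e ->
  exists N, forall n, (N <= n)%N -> n%:R ^+ 2 * (1 - p ^+ 2) ^+ (n - 2) <= e.
Proof.
move=> /andP[p0 p1] e0; set r := 1 - p ^+ 2.
have r0 : 0 < r by rewrite /r; nra.
have r1 : r < 1 by rewrite /r; nra.
have [a /andP[a0 a1] ra] : exists2 a, 0 < a <= 1 & r * (1 + a) ^+ 3 < 1.
  by apply: exp_gap; rewrite ltW.
pose t := r * (1 + a) ^+ 2.
have t01 : 0 <= t < 1.
  have h0 : 0 <= t by apply: mulr_ge0; [lra|apply: sqr_ge0].
  rewrite h0 /=; apply: le_lt_trans ra; rewrite exprSr mulrA -/t; nra.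
have C0 : 0 < r ^+ 2 * a ^+ 2 by rewrite mulr_gt0 // exprn_gt0.
have [|N HN] := @geometric_small (r ^+ 2 * a ^+ 2)^-1 t e _ t01 e0.
  by rewrite invr_ge0 ltW.
exists (maxn N 2) => n; rewrite geq_max => /andP[/HN Nn n2].
apply: le_trans Nn; rewrite -(ler_pM2l C0) [leRHS]mulrA mulfV ?gt_eqF // mul1r.
have -> : r ^+ 2 * a ^+ 2 * (n%:R ^+ 2 * r ^+ (n - 2)) = r ^+ n * (n%:R * a) ^+ 2.
  have -> : r ^+ n = r ^+ (n - 2) * r ^+ 2 by rewrite -exprD subnK.
  by rewrite exprMn; ring.
have -> : t ^+ n = r ^+ n * ((1 + a) ^+ n) ^+ 2 by rewrite /t exprMn -!exprM mulnC.
apply: ler_wpM2l; first by rewrite exprn_ge0 // ltW.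
have := natr_le_exp n (ltW a0); set u := _ * a; set v := _ ^+ n => uv.
have u0 : 0 <= u by rewrite /u mulr_ge0 ?ler0n // ltW.
by rewrite !expr2; apply: ler_pM.
Qed.

(** With [s] of order [n / (2 * m)], both the number of sets of cardinality at most
    [s] and the loss [rho ^- s.*2] grow by a factor per vertex that tends to 1 as
    [m] grows, so some fixed [m] leaves a geometric decay. *)
Lemma sparse_error_small (rho : R) : 0 < rho < 1 ->
  exists2 m, (0 < m)%N & forall e, 0 < e -> exists N, forall n, (N <= n)%N ->
    let s := (n %/ (4 * m)).*2.+1 in
    n%:R * #|small_sets n s|%:R ^+ 2 * rho ^+ (n - s.*2) <= e.
Proof.
move=> /andP[r0 r1].
have [a /andP[a0 a1] ra] : exists2 a, 0 < a <= 1 & rho * (1 + a) ^+ 3 < 1.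
  by apply: exp_gap; rewrite ltW.
set th := rho * (1 + a) ^+ 3 in ra.
have b0 : 0 < 1 + a by lra.
have th0 : 0 < th by rewrite mulr_gt0 // exprn_gt0.
(* [th < phi < 1]: the entropy and the decay together give [th ^+ n], and [m] is
   chosen so that the dependence on [s] costs at most [phi ^- n]. *)
pose phi := (1 + th) / 2.
have phi0 : 0 < phi by rewrite /phi; lra.
have phi1 : phi < 1 by rewrite /phi; lra.
have thphi : th < phi by rewrite /phi; lra.
pose k := a * rho.
have k0 : 0 < k by rewrite mulr_gt0.
have [M HM] : exists N, forall n, (N <= n)%N -> 1 * phi ^+ n <= k.
  by apply: geometric_small => //; rewrite ltW.
have [m m2 pk] : exists2 m, (1 < m)%N & phi ^+ m <= k.
  by exists M.+2 => //; rewrite -[leLHS]mul1r HM // !leqW.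
exists m => [|e e0]; first exact: ltnW.
pose t := th / phi.
have t01 : 0 <= t < 1.
  by rewrite divr_ge0 ?ltW //= ltr_pdivrMr // mul1r.
have C0 : 0 < a * k ^+ 2 by rewrite mulr_gt0 // exprn_gt0.
have [|N HN] := @geometric_small (a * k ^+ 2)^-1 t e _ t01 e0.
  by rewrite invr_ge0 ltW.
exists (maxn N 4) => n; rewrite geq_max => /andP[/HN Nn n4] /=.
set h := (n %/ _)%N; set s := h.*2.+1.
have hm : (4 * h * m <= n)%N by rewrite mulnAC mulnC leq_trunc_div.
clearbody h.
have sE : (s.*2 = 2 + 4 * h)%N by rewrite /s doubleS -!muln2 -mulnA mulnC.
have sn : (s.*2 <= n)%N.
  rewrite sE -leq_double doubleD -[leqRHS]addnn leq_add // -muln2 (leq_trans _ hm) //.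
  by rewrite leq_mul2l m2 orbT.
apply: le_trans Nn; rewrite -(ler_pM2l C0) [leRHS]mulrA mulfV ?gt_eqF // mul1r.
rewrite /t expr_div_n ler_pdivlMr ?exprn_gt0 //.
have phk : phi ^+ n <= k ^+ (4 * h).
  apply: (@le_trans _ _ (phi ^+ (m * (4 * h)))).
    by apply: ler_wiXn2l; rewrite ?ltW // mulnC.
  by rewrite exprM; apply: lerXn2r; rewrite // nnegrE ltW // exprn_gt0.
set S := #|_|%:R; set X := n%:R * _ * _.
have X0 : 0 <= X by rewrite !mulr_ge0 ?ler0n ?sqr_ge0 ?exprn_ge0 // ltW.
have aX0 : 0 <= a * k ^+ 2 * X by rewrite mulr_ge0 // ltW.
apply: le_trans (ler_wpM2l aX0 phk) _.
have -> : a * k ^+ 2 * X * k ^+ (4 * h) = rho ^+ n * ((n%:R * a) * (S * a ^+ s) ^+ 2).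
  have -> : rho ^+ n = rho ^+ (n - s.*2) * rho ^+ s.*2 by rewrite -exprD subnK.
  have -> : (S * a ^+ s) ^+ 2 = S ^+ 2 * a ^+ (2 + 4 * h).
    by rewrite exprMn -exprM muln2 sE.
  rewrite /X sE /k !exprMn !exprD; ring.
have -> : th ^+ n = rho ^+ n * ((1 + a) ^+ n) ^+ 3 by rewrite /th exprMn -!exprM mulnC.
apply: ler_wpM2l; first by rewrite exprn_ge0 // ltW.
have := natr_le_exp n (ltW a0).
have := @card_small_sets a n s _; rewrite -/S ltW //= a1 => /(_ isT).
set A := (1 + a) ^+ n; set u := S * _; set v := n%:R * a => uA vA.
have u0 : 0 <= u by rewrite mulr_ge0 ?ler0n ?exprn_ge0 // ltW.
have v0 : 0 <= v by rewrite mulr_ge0 ?ler0n // ltW.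
by rewrite [leRHS]exprS; apply: ler_pM => //; rewrite ?sqr_ge0 // !expr2; apply: ler_pM.
Qed.

End Asymptotics.

Theorem theorem8 (R : realType) (p : R) (hp0 : 0 < p) (hp1 : p < 1)
    (C : forall n : nat, 'M[R]_n) :
  (fun n : nat => gnp_prob p (fun E => \det (dist_mx (C n) E) == 0))
    @ \oo --> (0 : R).
Proof.
have p01 : 0 <= p <= 1 by rewrite !ltW.
pose rho := Num.max p (1 - p); pose tau := p * (1 - p).
have [pr qr] : p <= rho /\ 1 - p <= rho by rewrite !le_max !lexx orbT.
have rho01 : 0 < rho < 1 by rewrite lt_max hp0 gt_max hp1; lra.
have tau0 : 0 < tau by rewrite mulr_gt0 //; lra.
have [m m0 sparse_small] := sparse_error_small rho01.
have m0R : 0 < m%:R :> R by rewrite ltr0n.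
apply/cvgrPdist_le => e e0; have e3 : 0 < e / 3 by lra.
(* The double counting multiplies [eps] by at most [2 * m]. *)
pose eps := e / 3 / (2 * m%:R).
have eps0 : 0 < eps by rewrite divr_gt0 // mulr_gt0.
pose delta := Num.min eps (eps ^+ 4 / 3).
have delta0 : 0 < delta by rewrite lt_min eps0 divr_gt0 // exprn_gt0.
have de : delta <= eps by rewrite ge_min lexx.
have de4 : 3 * delta <= eps ^+ 4.
  have : delta <= eps ^+ 4 / 3 by rewrite ge_min lexx orbT.
  by lra.
have dt0 : 0 < delta ^+ 2 * tau by rewrite mulr_gt0 // exprn_gt0.
(* [H] is the support size from which both Littlewood-Offord bounds hold. *)
pose H := Num.bound (2 / (delta ^+ 2 * tau)).
have HH : 2 <= delta ^+ 2 * (tau * H%:R).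
  rewrite mulrA mulrC -ler_pdivrMr // ltW // /H.
  by apply: archi_boundP; rewrite divr_ge0 // ltW.
have [|N1 HN1] := @diameter_error_small _ p _ _ e3; first by rewrite hp0.
have [N2 HN2] := sparse_small _ e3.
exists (maxn (maxn N1 N2) (maxn 1 (H * (4 * m)))) => // n.
rewrite /= !geq_max => /andP[/andP[/HN1 B1 /HN2 B2] /andP[n0 Hn]].
set h := (n %/ (4 * m))%N in B2.
have ep01 := @edge_prob01 R n p p01.
rewrite sub0r normrN gnp_probE ger0_norm ?prob_ge0 //.
have hn : (h < n)%N.
  by apply: ltn_Pdiv => //; apply: (@leq_trans 4) => //; apply: leq_pmulr.
have dh : 2 <= delta ^+ 2 * (tau * h%:R).
  apply: le_trans HH _; rewrite mulrA [leRHS]mulrA; apply: ler_wpM2l; first exact: ltW.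
  by rewrite ler_nat leq_divRL // muln_gt0.
apply: (@le_trans _ _ (prob (edge_prob p) (fun x => ~~ common_neighbours x) +
    prob (edge_prob p) (fun x => \det (dist2_mx R x) == 0))).
  apply: prob_or => // x /andP[_]; have [cn|_] := boolP (common_neighbours x); last by left.
  by rewrite dist_mx_common_neighbours //; right.
have Pdet := @prob_det_dist2 R n p tau delta eps h p01 (ltW tau0) (lexx _) (ltW delta0)
  (ltW eps0) de de4 dh hn.
have r1 : rho <= 1 by rewrite ltW //; case/andP: rho01.
have Psparse := le_trans (@prob_sparse_defect R n p p01 rho h.*2.+1 pr qr r1) B2.
have Pcn := le_trans (@prob_no_common_neighbours n R p p01) B1.
have : n%:R / h.*2.+2%:R * eps <= e / 3.
  have epsE : eps * (2 * m%:R) = e / 3 by rewrite divfK // gt_eqF // mulr_gt0.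
  have nm : (n <= 2 * m * h.*2.+2)%N.
    by rewrite -doubleS -muln2 mulnCA (mulnAC 2) ltnW // ltn_ceil // muln_gt0.
  rewrite mulrAC ler_pdivrMr ?ltr0n // -epsE mulrC -[leRHS]mulrA ler_pM2l //.
  by rewrite -!natrM ler_nat.
have e33 : e / 3 + (e / 3 + e / 3) = e by lra.
move=> Pmarkov; rewrite -e33.
exact: lerD Pcn (le_trans Pdet (lerD Psparse Pmarkov)).
Qed.
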